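(* Let $\mathcal{H}$ and $\mathcal{G}$ be real Hilbert spaces, let $f\in\Gamma_0(\mathcal{H})$, and let $M\colon\mathcal{H}\to\mathcal{G}$ be a bounded linear operator with adjoint $M^*$ such that $0\in\operatorname{sri}(\operatorname{ran}M^*-\operatorname{dom}f)$ and $MM^*-\mathrm{Id}_{\mathcal{G}}$ is positive. Set $q_{\mathcal{H}}=\|\cdot\|_{\mathcal{H}}^2/2$ and $q_{\mathcal{G}}=\|\cdot\|_{\mathcal{G}}^2/2$. Then $M\triangleright\operatorname{prox}_f\in\mathcal{P}(\mathcal{G})$. More specifically, $$M\triangleright\operatorname{prox}_f=\operatorname{prox}_{\varphi},\quad\text{where}\quad \varphi=(f+q_{\mathcal{H}})\circ M^*-q_{\mathcal{G}}.$$
   Context: For a real Hilbert space $\mathcal{X}$: $\Gamma_0(\mathcal{X})$ is the class of lower semicontinuous convex functions $f\colon\mathcal{X}\to\left]-\infty,+\infty\right]$ with $\operatorname{dom}f=\{x\in\mathcal{X}\mid f(x)<+\infty\}\neq\varnothing$. For $f\in\Gamma_0(\mathcal{X})$, the proximity operator $\operatorname{prox}_f\colon\mathcal{X}\to\mathcal{X}$ maps $x$ to the unique minimizer over $y\in\mathcal{X}$ of $f(y)+\frac12\|x-y\|^2$. $\mathcal{P}(\mathcal{X})$ is the set of operators $T\colon\mathcal{X}\to\mathcal{X}$ such that $T=\operatorname{prox}_f$ for some $f\in\Gamma_0(\mathcal{X})$. A bounded linear operator $A\colon\mathcal{X}\to\mathcal{X}$ is positive if $\langle x\mid Ax\rangle\geq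 0$ for every $x\in\mathcal{X}$. For a convex set $C\subset\mathcal{X}$, the strong relative interior $\operatorname{sri}C$ is the set of $x\in C$ such that the cone generated by $C-x$ is a closed vector subspace of $\mathcal{X}$. The inverse $A^{-1}$ of a set-valued operator $A$ is the set-valued operator with graph $\{(u,x)\mid u\in Ax\}$. The parallel composition of $A\colon\mathcal{H}\to 2^{\mathcal{H}}$ by a bounded linear operator $M\colon\mathcal{H}\to\mathcal{G}$ is the operator $M\triangleright A=(M\circ A^{-1}\circ M^* )^{-1}\colon\mathcal{G}\to 2^{\mathcal{G}}$. Single-valued operators are identified with set-valued operators having the same graph. $\mathrm{Id}_{\mathcal{G}}$ is the identity operator of $\mathcal{G}$. *)

(* Defs.v *)
From HB Require Import structures.
From mathcomp Require Import all_boot all_order all_algebra sesquilinear.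
From mathcomp Require Import all_classical all_reals all_analysis.

Set Implicit Arguments.
Unset Strict Implicit.
Unset Printing Implicit Defensive.

Import Order.TTheory GRing.Theory Num.Theory.
Import numFieldNormedType.Exports.

Local Open Scope classical_set_scope.
Local Open Scope ring_scope.

(* [{dot H for idfun}] is the type of symmetric positive definite bilinear
   forms on [H]; the structure is thus that of real Hilbert spaces. *)
HB.mixin Record NormedModule_isHilbert (R : realType) H
    of CompleteNormedModule R H := {
  inner : {dot H for idfun} ;
  inner_normE : forall x, inner x x = `|x| ^+ 2
}.

#[short(type="hilbertType")]
HB.structure Definition Hilbert (R : realType) :=
  { H of NormedModule_isHilbert R H & CompleteNormedModule R H }.

Section ConvexAnalysis.
Context {R : realType} {X : hilbertType R}.
Implicit Types (f : X -> \bar R) (C : set X).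

Definition effective_domain f : set X := [set x | (f x < +oo)%E].

(* For functions that never take the value [-oo], so that the right-hand side
   is never an indeterminate sum. *)
Definition econvex f := forall (t : R) (x y : X), 0 < t -> t < 1 ->
  (f (t *: x + (1 - t) *: y)%R <= t%:E * f x + (1 - t)%:E * f y)%E.

Definition Gamma0 f :=
  [/\ forall x, f x != -oo%E, lower_semicontinuous f, econvex f
    & effective_domain f !=set0].

Definition halfsqnorm (x : X) : R := `|x| ^+ 2 / 2.

Definition minimizer (g : X -> \bar R) (p : X) := forall y, (g p <= g y)%E.

(* The default value [0] is not used when [Gamma0 f] holds: the minimizer then
   exists and is unique for every [x]. *)
Definition prox f (x : X) : X :=
  xget 0 [set p | unique (minimizer (fun y => f y + (halfsqnorm (x - y))%:E)%E) p].

Definition prox_operators : set (X -> X) :=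
  [set T | exists2 f, Gamma0 f & T = prox f].

Definition positive_operator (A : X -> X) := forall x, 0 <= inner x (A x).

Definition generated_cone C : set X :=
  [set z | exists2 t : R, 0 < t & exists2 c, C c & z = t *: c].

Definition closed_subspace C := closed C /\ submod_closed (mem C).

Definition sri C : set X :=
  [set x | C x /\ closed_subspace (generated_cone [set c - x | c in C])].

End ConvexAnalysis.

Section SetValued.

Definition graph {X Y : Type} (T : X -> Y) : X -> set Y := fun x => [set T x].

Definition svinv {X Y : Type} (A : X -> set Y) : Y -> set X :=
  fun u => [set x | A x u].

Definition svcomp {X Y Z : Type} (B : Y -> set Z) (A : X -> set Y) :
  X -> set Z := fun x => \bigcup_(y in A x) B y.

End SetValued.

Section Operators.
Context {R : realType} {H G : hilbertType R}.

Definition bounded_operator (M : H -> G) :=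
  exists c : R, forall x, `|M x| <= c * `|x|.

(* For [M] linear and bounded, the Riesz representation theorem provides
   exactly one such [u] for every [y]. *)
Definition adjoint (M : H -> G) (y : G) : H :=
  xget 0 [set u | forall x, inner (M x) y = inner x u].

Definition parallel_comp (M : H -> G) (A : H -> set H) : G -> set G :=
  svinv (svcomp (graph M) (svcomp (svinv A) (graph (adjoint M)))).

End Operators.

(* Main.v *)
(* Writing h = f + q, the graph of M |> prox_f consists of the pairs (M x, p)
   with prox_f x = M^* p, i.e. x in the subdifferential of h at M^* p; then M x
   is a subgradient of h o M^* at p, which says p = prox_phi (M x). It remains
   to solve M x = y, prox_f x in ran M^* for every y. As M M^* >= Id, M M^* is
   onto, so M x0 = y for some x0, and the solutions of M x = y are x0 + n with
   n in N = ker M. Since prox_f is the gradient of the conjugate h^*, any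
   minimizer n of h^*(x0 + n) over N makes prox_f (x0 + n) orthogonal to N,
   hence an element of ran M^*. Such a minimizer exists because the
   qualification condition and the uniform boundedness principle make the
   sublevel sets of this problem bounded, up to the orthogonal complement of
   the cone W generated by ran M^* - dom f, along which nothing is lost. *)
From HB Require Import structures.
Require Import Defs.
From mathcomp Require Import all_boot all_order all_algebra sesquilinear.
From mathcomp Require Import all_classical all_reals all_analysis.
From mathcomp Require Import ring lra.

Set Implicit Arguments.
Unset Strict Implicit.
Unset Printing Implicit Defensive.

Import Order.TTheory GRing.Theory Num.Theory.
Import numFieldNormedType.Exports.

Local Open Scope classical_set_scope.
Local Open Scope ring_scope.

(** * Inner product calculus and continuity *)

Section InnerProduct.
Context {R : realType} {H : hilbertType R}.
Implicit Types (x y z : H) (t : R).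

Lemma innerC x y : inner x y = inner y x.
Proof. by rewrite hermC expr0 mul1r. Qed.

Lemma innerDl x y z : inner (x + y) z = inner x z + inner y z.
Proof. by rewrite linearDl. Qed.

Lemma innerDr x y z : inner z (x + y) = inner z x + inner z y.
Proof. by rewrite linearDr. Qed.

Lemma innerZl t x z : inner (t *: x) z = t * inner x z.
Proof. by rewrite linearZl_LR. Qed.

Lemma innerZr t x z : inner z (t *: x) = t * inner z x.
Proof. by rewrite linearZr_LR. Qed.

Lemma innerNl x z : inner (- x) z = - inner x z.
Proof. by rewrite linearNl. Qed.

Lemma innerNr x z : inner z (- x) = - inner z x.
Proof. by rewrite linearNr. Qed.

Lemma inner0l z : inner 0 z = 0.
Proof. by rewrite linear0l. Qed.

Lemma inner0r z : inner z 0 = 0.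
Proof. by rewrite linear0r. Qed.

Definition innerE :=
  (innerDl, innerDr, innerNl, innerNr, innerZl, innerZr, inner0l, inner0r).

Lemma normsqE x : `|x| ^+ 2 = inner x x.
Proof. by rewrite inner_normE. Qed.

Lemma inner_ge0 x : 0 <= inner x x.
Proof. by rewrite -normsqE sqr_ge0. Qed.

Lemma inner_eq0 x : inner x x = 0 -> x = 0.
Proof. by rewrite -normsqE => /eqP; rewrite sqrf_eq0 normr_eq0 => /eqP. Qed.

Lemma eq_inner x y : (forall z, inner z x = inner z y) -> x = y.
Proof.
move=> xy; apply/eqP; rewrite -subr_eq0; apply/eqP/inner_eq0.
by rewrite innerDr innerNr xy subrr.
Qed.

Lemma cauchy_schwarz x y : `|inner x y| <= `|x| * `|y|.
Proof.
rewrite -(@ler_pXn2r _ 2) ?nnegrE ?mulr_ge0 //.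
rewrite exprMn real_normK ?num_real // !normsqE.
have [->|x0] := eqVneq x 0; first by rewrite !innerE; nra.
have xx : 0 < inner x x by rewrite -normsqE exprn_gt0 // normr_gt0.
(* This square equals [inner x x] times the Cauchy-Schwarz defect. *)
have := inner_ge0 (inner x x *: y - inner x y *: x).
by rewrite !innerE (innerC y x); nra.
Qed.

Lemma inner_continuous x : continuous (inner x : H -> R^o).
Proof.
apply: bounded_linear_continuous; apply/linear_boundedP.
near=> r => y; apply: (le_trans (cauchy_schwarz _ _)).
by apply: ler_wpM2r => //; near: r; exact: nbhs_pinfty_ge.
Unshelve. all: by end_near. Qed.

Lemma halfsqnormE x : halfsqnorm x = inner x x / 2.
Proof. by rewrite /halfsqnorm normsqE. Qed.

Lemma halfsqnorm_continuous : continuous (@halfsqnorm R H : H -> R^o).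
Proof.
move=> x; rewrite /halfsqnorm; apply: cvgMl; apply: cvgM; exact: cvg_norm.
Qed.

Lemma closed_orth (C : set H) :
  closed [set x | forall y, C y -> inner y x = 0].
Proof.
rewrite [X in closed X](_ : _ =
    \bigcap_(y in C) ((inner y : H -> R^o) @^-1` [set 0])); last first.
  by apply/seteqP; split => x /= Hx y; exact: Hx.
apply: closed_bigI => y _; apply: closed_comp; last exact: closed_eq.
by move=> ? _; exact: inner_continuous.
Qed.

End InnerProduct.

(** Let [t] tend to 0. Optimality conditions below come from this after dividing a perturbation
    inequality by [t]. *)
Lemma ge0_of_affine {R : realType} (a b : R) :
  (forall t, 0 < t -> t < 1 -> 0 <= a + t * b) -> 0 <= a.
Proof.
move=> ab; rewrite leNgt; apply/negP => a0.
have b0 : 0 <= `|b| := normr_ge0 b.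
have bb : b <= `|b| := ler_norm b.
pose d := 2 * (`|b| + 1 - a); pose u := - a / d.
have d0 : 0 < d by rewrite /d; lra.
have u0 : 0 < u by rewrite divr_gt0 //; lra.
have u1 : u < 1 by rewrite ltr_pdivrMr // /d; lra.
have ud : u * d = - a by rewrite divfK ?gt_eqF.
have ub := ab _ u0 u1.
have : 0 <= u * (`|b| - b) by rewrite mulr_ge0; lra.
have : 0 < u * (1 - a) by rewrite mulr_gt0; lra.
move: ud; rewrite /d; nra.
Qed.

(** * Existence of minimizers without weak topologies *)

Section Minimization.
Context {R : realType} {H : hilbertType R}.
Implicit Types (x y z : H) (t : R) (C : set H).

Definition midconvex C :=
  forall x y, C x -> C y -> C (2^-1 *: (x + y)).

(* Almost minimal norm elements of the [K j] form a Cauchy sequence, by the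
   parallelogram law; this replaces weak compactness. *)
Lemma nested_closed_convex (K : nat -> set H) (B : R) :
  (forall j, closed (K j)) -> (forall j, midconvex (K j)) ->
  (forall i j, (i <= j)%N -> K j `<=` K i) ->
  (forall j, exists2 x, K j x & `|x| <= B) ->
  exists x, forall j, K j x.
Proof.
move=> Kcl Kcvx Kdec KB.
have invS0 (j : nat) : 0 < j.+1%:R^-1 :> R by rewrite invr_gt0.
pose S j := [set inner x x | x in K j]; pose r j := inf (S j).
have Sinf j : has_inf (S j).
  split; first by have [x Kx _] := KB j; exists (inner x x), x.
  by exists 0 => _ [x _ <-]; exact: inner_ge0.
have rle j x : K j x -> r j <= inner x x.
  by move=> Kx; apply: ge_inf; [case: (Sinf j) | exists x].
have rsup : has_sup (range r).
  split; first by exists (r 0%N), 0%N.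
  exists (B ^+ 2) => _ [j _ <-]; have [x Kx xB] := KB j.
  apply: (le_trans (rle _ _ Kx)).
  by rewrite -normsqE ler_pXn2r ?nnegrE // (le_trans _ xB).
pose m := sup (range r).
have rm j : r j <= m by apply: ub_le_sup; [case: rsup | exists j].
have pex j : exists x, K j x /\ inner x x < r j + j.+1%:R^-1.
  have [_ [x Kx <-] xr] := inf_adherent (invS0 j) (Sinf j).
  by exists x.
have [p pP] := choice pex.
(* The midpoint of [p J] and [p i] lies in [K J], so its squared norm is at least [r J]; the
   parallelogram law then bounds the distance, since [r J] is within [e] of the upper bound [m]. *)
have pclose J i (e : R) : (J <= i)%N -> 0 < e -> J.+1%:R^-1 < e -> m - e < r J ->
    `|p J - p i| ^+ 2 <= 8 * e.
  move=> Ji e0 Je mJ.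
  have [KJ pJ] := pP J; have [Ki pi_] := pP i.
  have Ki' := Kdec _ _ Ji _ Ki.
  have := rle _ _ (Kcvx _ _ _ KJ Ki').
  have : i.+1%:R^-1 <= J.+1%:R^-1 :> R by rewrite lef_pV2 ?posrE // ler_nat.
  move: (rm J) (rm i); rewrite normsqE !innerE (innerC (p i) (p J)).
  move: pJ pi_; set a := inner _ _; set b := inner _ _; set c := inner _ _.
  set u := (J.+1%:R^-1) in Je *; set v := (i.+1%:R^-1).
  move=> h1 h2 h3 h4 h5 h6.
  have h7 : 4 * r J <= a + 2 * c + b by lra.
  lra.
have pcvg : cvg (p @ \oo).
  apply: cauchy_cvg; apply: cauchy_exP => e e0.
  pose d := e ^+ 2 / 16.
  have d0 : 0 < d by rewrite divr_gt0 // exprn_gt0.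
  have [_ [J1 _ <-] J1m] := sup_adherent d0 rsup.
  have [J2 _ J2d] : \forall n \near \oo, n.+1%:R^-1 < d.
    exact: near_infty_natSinv_lt (PosNum d0).
  pose J := maxn J1 J2.
  exists (p J); exists J => // i /= Ji.
  rewrite -ball_normE /=.
  have rJ : r J1 <= r J.
    apply: lb_le_inf; first by case: (Sinf J).
    move=> _ [x Kx <-]; apply: rle; apply: Kdec Kx; exact: leq_maxl.
  have := pclose J i d Ji d0 (J2d _ (leq_maxr _ _)) (lt_le_trans J1m rJ).
  rewrite -(@ltr_pXn2r _ 2) ?nnegrE //; last exact: ltW.
  have e2 : 0 < e ^+ 2 by rewrite exprn_gt0.
  by rewrite /d => h; lra.
exists (lim (p @ \oo)) => j.
apply: (closed_cvg _ (Kcl j)) pcvg.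
exists j => // i /= ji; apply: (Kdec _ _ ji); exact: (pP i).1.
Qed.

(** Sublevel sets at levels decreasing to the infimum are nested, closed and midpoint convex, and
    each contains a point of norm at most [B]; a common point attains the infimum. *)
Lemma exists_minimizer (F : H -> \bar R) (c B : R) :
  (forall a : R, closed [set x | (F x <= a%:E)%E]) ->
  (forall a : R, midconvex [set x | (F x <= a%:E)%E]) ->
  (exists x, (F x <= c%:E)%E) ->
  (forall x, (F x <= c%:E)%E -> `|x| <= B) ->
  exists p, minimizer F p.
Proof.
move=> Fcl Fcvx [x0 Fx0] FB.
have lev (a : nat -> R) : (forall i j, (i <= j)%N -> a j <= a i) ->
    (forall j, exists x, (F x <= (a j)%:E)%E) ->
    exists p, forall j, (F p <= (a j)%:E)%E.
  move=> adec aF.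
  apply: (@nested_closed_convex (fun j => [set x | (F x <= (a j)%:E)%E]) B) => //.
    by move=> i j ij x /= /le_trans; apply; rewrite lee_fin adec.
  move=> j; have [x Fx] := aF j.
  have [ac|ca] := leP (a j) c.
    by exists x => //; apply: FB; rewrite (le_trans Fx) // lee_fin.
  by exists x0; [rewrite /= (le_trans Fx0) // lee_fin ltW | exact: FB].
pose S := [set a : R | exists x, (F x <= a%:E)%E].
(* If the levels are unbounded below, the levels [- j] produce a point where [F] is [-oo], which is
   a minimizer. *)
have [Slb|Slb] := pselect (has_lbound S); last first.
  have [p Fp] : exists p, forall j : nat, (F p <= (- j%:R)%:E)%E.
    apply: lev => [i j ij|j]; first by rewrite lerN2 ler_nat.
    apply: contrapT => nF; apply: Slb; exists (- j%:R) => a [x Fx].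
    rewrite leNgt; apply/negP => aj; apply: nF; exists x.
    by rewrite (le_trans Fx) // lee_fin ltW.
  exists p => y; rewrite (_ : F p = -oo%E) ?leNye //.
  apply/eqP; rewrite -leeNy_eq; case FpE : (F p) => [r| |] //.
    have := Fp (Num.truncn `|r|).+1; rewrite FpE lee_fin => h.
    have := truncnS_gt `|r|; have := ler_norm (- r); rewrite normrN.
    by move: h; clear => *; exfalso; lra.
  by have := Fp 0%N; rewrite FpE.
have Sinf : has_inf S by split => //; exists c, x0.
have invS0 (j : nat) : 0 < j.+1%:R^-1 :> R by rewrite invr_gt0.
pose m := inf S.
have [p Fp] : exists p, forall j : nat, (F p <= (m + j.+1%:R^-1)%:E)%E.
  apply: lev => [i j ij|j]; first by rewrite lerD2l lef_pV2 ?posrE // ler_nat.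
  have [a [x Fx] am] := inf_adherent (invS0 j) Sinf.
  by exists x; rewrite (le_trans Fx) // lee_fin ltW.
have Fpm : (F p <= m%:E)%E.
  apply/lee_addgt0Pr => e e0.
  have [j _ je] : \forall n \near \oo, n.+1%:R^-1 < e.
    exact: near_infty_natSinv_lt (PosNum e0).
  by rewrite (le_trans (Fp j)) // -EFinD lee_fin lerD2l ltW // je /=.
exists p => y; rewrite (le_trans Fpm) //.
case Fy : (F y) => [r| |]; rewrite ?leey //.
  by rewrite lee_fin; apply: ge_inf; [case: Sinf | exists y; rewrite Fy].
have : S (m - 1) by exists y; rewrite Fy leNye.
by move=> /(ge_inf Sinf.2); rewrite -/m; clear => *; exfalso; lra.
Qed.

Lemma closed_sublevel (F : H -> \bar R) (a : R) :
  lower_semicontinuous F -> closed [set x | (F x <= a%:E)%E].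
Proof.
move=> /lower_semicontinuousP /(_ a) /open_closedC.
by congr closed; apply/seteqP; split => x /=; rewrite leNgt => /negP.
Qed.

End Minimization.

(** * The class [Gamma0], proximity operators and subgradients *)

Section Gamma0Theory.
Context {R : realType} {H : hilbertType R}.
Implicit Types (f : H -> \bar R) (x y p u : H) (t : R).

Lemma econvex_le f x y t a b : econvex f -> 0 < t -> t < 1 ->
  (f x <= a%:E)%E -> (f y <= b%:E)%E ->
  (f (t *: x + (1 - t) *: y)%R <= (t * a + (1 - t) * b)%R%:E)%E.
Proof.
move=> fcvx t0 t1 fx fy; apply: (le_trans (fcvx _ _ _ t0 t1)).
rewrite (EFinD (t * a)) !EFinM.
by apply: leeD; apply: lee_wpmul2l => //;
  rewrite lee_fin; lra.
Qed.

Lemma econvexP f : (forall x, f x != -oo%E) ->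
  (forall t x y a b, 0 < t -> t < 1 -> f x = a%:E -> f y = b%:E ->
    (f (t *: x + (1 - t) *: y)%R <= (t * a + (1 - t) * b)%R%:E)%E) ->
  econvex f.
Proof.
move=> fNy fab t x y t0 t1.
have t1' : 0 < 1 - t by lra.
case fx : (f x) (fNy x) => [a| |] // _; last first.
  rewrite mulry gtr0_sg // mul1e.
  case fy : (f y) (fNy y) => [b| |] // _.
    by rewrite -EFinM addye // leey.
  by rewrite mulry gtr0_sg // mul1e addye // leey.
case fy : (f y) (fNy y) => [b| |] // _; last first.
  by rewrite mulry gtr0_sg // mul1e -EFinM addey // leey.
by rewrite -!EFinM -EFinD; exact: fab.
Qed.

Lemma effective_domainP f x : Gamma0 f -> (f x < +oo)%E -> exists a, f x = a%:E.
Proof. by case=> /(_ x); case: (f x) => // a _ _ _ _ _; exists a. Qed.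

Lemma midconvex_sublevel f (a : R) : econvex f ->
  midconvex [set x | (f x <= a%:E)%E].
Proof.
move=> fcvx x y /= fx fy; have -> : 2^-1 *: (x + y) = 2^-1 *: x + (1 - 2^-1) *: y.
  by rewrite scalerDr; congr (_ + _ *: _); lra.
have := @econvex_le f x y 2^-1 a a fcvx _ _ fx fy.
have -> : 2^-1 * a + (1 - 2^-1) * a = a by lra.
by apply; lra.
Qed.

Lemma lower_semicontinuousD f (g : H -> R^o) : (forall x, f x != -oo%E) ->
  lower_semicontinuous f -> continuous g ->
  lower_semicontinuous (fun x => f x + (g x)%:E)%E.
Proof.
move=> fNy flsc gcont x a afg.
(* The threshold [a] is split as [b + (a - b)]: near [x], [f] stays above [b] and [g] above
   [a - b]. *)
have [b abf bf] : exists2 b : R, a - g x < b & (b%:E < f x)%E.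
  case fx : (f x) (fNy x) afg => [c| |] // _.
    rewrite -EFinD lte_fin => ac; exists ((a - g x + c) / 2); first lra.
    by rewrite lte_fin; lra.
  by exists (a - g x + 1); [lra | exact: ltry].
have [V Vx Vf] := flsc _ _ bf.
exists (V `&` [set y | a - b < g y]).
  apply: filterI => //.
  by apply: (cvgr_gt (g x) (gcont x)); lra.
move=> y [/Vf + /=]; case: (f y) (fNy y) => [c| |] // _.
  by rewrite !lte_fin => *; lra.
by rewrite addye // => *; exact: ltry.
Qed.

Lemma Gamma0D f (g : H -> R^o) : Gamma0 f -> continuous g ->
  (forall t x y, 0 < t -> t < 1 ->
    g (t *: x + (1 - t) *: y) <= t * g x + (1 - t) * g y) ->
  Gamma0 (fun x => f x + (g x)%:E)%E.
Proof.
move=> f0 gcont gcvx; have [fNy flsc fcvx [d fd]] := f0.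
have fgNy x : (f x + (g x)%:E)%E != -oo%E.
  by case: (f x) (fNy x).
split => //; first exact: lower_semicontinuousD.
  apply: econvexP => // t x y a b t0 t1.
  case fx : (f x) => [c| |] //; case fy : (f y) => [e| |] // [<-] [<-].
  have := @econvex_le f x y t c e fcvx t0 t1.
  rewrite fx fy => /(_ (lexx _) (lexx _)).
  case: (f (_ + _)) (fNy (t *: x + (1 - t) *: y)) => [k| |] // _.
  rewrite -EFinD !lee_fin => h; have := gcvx _ x y t0 t1; lra.
exists d; move: fd; rewrite /effective_domain /=.
by case: (f d) (fNy d) => // r _ _; rewrite -EFinD ltry.
Qed.

(** Stands in for a continuous affine minorant. Lower semicontinuity gives [f > e - 1] on a ball
    around [d]; convexity along segments from [d] propagates this outside the ball with linear
    loss. *)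
Lemma Gamma0_minorant f : Gamma0 f ->
  exists d a b, 0 <= b /\ forall y c, (f y <= c%:E)%E -> a - b * `|y - d| <= c.
Proof.
move=> f0; have [fNy flsc fcvx [d /(effective_domainP f0)[e fd]]] := f0.
have : ((e - 1)%:E < f d)%E by rewrite fd lte_fin; lra.
move=> /flsc[V /nbhs_ballP[r /= r0 rV] Vf].
exists d, (e - 1), (2 / r); split; first by rewrite divr_ge0 // ltW.
move=> y c fy; set s := `|y - d|.
have [sr|rs] := ltP s r.
  have : V y by apply: rV; rewrite -ball_normE /= distrC.
  move=> /Vf /lt_le_trans /(_ fy); rewrite lte_fin => h.
  have : 0 <= 2 / r * s.
    by apply: mulr_ge0; [rewrite divr_ge0 // ltW | exact: normr_ge0].
  lra.
have s0 : 0 < s by exact: lt_le_trans rs.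
(* This [t] puts the point of the segment at distance [r / 2] from [d], inside the ball. *)
pose t := r / (2 * s).
have t0 : 0 < t by rewrite divr_gt0 // mulr_gt0.
have t1 : t < 1 by rewrite ltr_pdivrMr; lra.
have := @econvex_le f y d t c e fcvx t0 t1 fy; rewrite fd => /(_ (lexx _)).
have : V (t *: y + (1 - t) *: d).
  apply: rV; rewrite -ball_normE /= distrC scalerBl scale1r addrCA addrAC subrr add0r.
  rewrite -scalerBr normrZ gtr0_norm // -/s /t invfM mulrA divfK ?gt_eqF //; lra.
move=> /Vf /lt_le_trans h /h; rewrite lte_fin => h2.
have -> : 2 / r = (t * s)^-1 by rewrite /t; field; rewrite !gt_eqF.
rewrite invfM divfK ?gt_eqF // lerBlDr -(ler_pM2l t0).
have : t * t^-1 = 1 by rewrite mulfV // gt_eqF.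
nra.
Qed.

Lemma exists_prox f x : Gamma0 f ->
  exists p, minimizer (fun y => f y + (halfsqnorm (x - y)%R)%:E)%E p.
Proof.
move=> f0; have [fNy flsc fcvx [z /(effective_domainP f0)[e fz]]] := f0.
have [d [a [b [b0 fmin]]]] := Gamma0_minorant f0.
have [_ Flsc Fcvx _] : Gamma0 (fun y => f y + (halfsqnorm (x - y)%R)%:E)%E.
  apply: Gamma0D => //.
    move=> y.
    apply: (@continuous_comp _ _ _ (fun y => x - y) (@halfsqnorm R H : H -> R^o)).
      by apply: cvgB; [exact: cvg_cst | exact: cvg_id].
    exact: halfsqnorm_continuous.
  move=> t y v t0 t1; rewrite !halfsqnormE !innerE.
  have := inner_ge0 (y - v); rewrite !innerE (innerC v y) (innerC y x) (innerC v x).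
  move=> h; have := mulr_ge0 (mulr_ge0 (ltW t0) (_ : 0 <= 1 - t)) h; nra.
pose c := e + halfsqnorm (x - z).
(* With [s] the distance from [x] to [y], the minorant turns membership in the level [c] into
   [s ^+ 2 / 2 - b * s <= k], which bounds [s]. *)
pose k := c - a + b * `|x - d|.
apply: (@exists_minimizer _ _ _ c (2 * b + 2 * `|k| + 1 + `|x|)).
- by move=> r; exact: closed_sublevel.
- by move=> r; exact: midconvex_sublevel.
- by exists z; rewrite fz -EFinD.
move=> y; case fy : (f y) (fNy y) => [r| |] // _; rewrite -EFinD lee_fin => rc.
have := fmin y r; rewrite fy => /(_ (lexx _)) ar.
have h1 : `|y - d| <= `|x - y| + `|x - d|.
  by rewrite -(distrC y x) -[y - d](subrKA x) ler_normD.
have h2 : `|y| <= `|x - y| + `|x|.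
  by rewrite -(distrC y x) -{1}[y](subrK x) ler_normD.
have h3 : b * `|y - d| <= b * (`|x - y| + `|x - d|) by rewrite ler_wpM2l.
suff : `|x - y| <= 2 * b + 2 * `|k| + 1 by lra.
have kk : k <= `|k| := ler_norm k.
rewrite leNgt; apply/negP => s1.
move: rc; rewrite {1}/halfsqnorm => rc.
have k0 : 0 <= `|k| := normr_ge0 k.
have : `|x - y| ^+ 2 / 2 - b * `|x - y| <= `|k| by move: kk; rewrite /k; lra.
move: s1 k0 b0; clear; nra.
Qed.

Definition subgradient f p u :=
  forall y, (f p + (inner u (y - p)%R)%:E <= f y)%E.

Lemma subgradient_fin f p u : Gamma0 f -> subgradient f p u ->
  exists a, f p = a%:E.
Proof.
case=> fNy _ _ [d fd] /(_ d); case: (f p) (fNy p) => [a| |] //; first by exists a.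
move=> _; rewrite addye // leye_eq => /eqP fdy.
by move: fd; rewrite /effective_domain /= fdy.
Qed.

Lemma subgradient_le f p u y a b : subgradient f p u -> f p = a%:E ->
  (f y <= b%:E)%E -> a + inner u (y - p) <= b.
Proof. by move=> /(_ y) + fp fy; rewrite fp -EFinD => /le_trans /(_ fy). Qed.

(** First-order optimality: compare [p] with points of the segment towards [y], divide by [t] and
    let [t] tend to 0. *)
Lemma minimizer_subgradient f x p : Gamma0 f ->
  minimizer (fun y => f y + (halfsqnorm (x - y)%R)%:E)%E p ->
  subgradient f p (x - p).
Proof.
move=> f0 pmin; have [fNy flsc fcvx [d /(effective_domainP f0)[e fd]]] := f0.
have [a fp] : exists a, f p = a%:E.
  have := pmin d; rewrite fd; case: (f p) (fNy p) => [a| |] //; by exists a.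
move=> y; rewrite fp -EFinD; case fy : (f y) (fNy y) => [b| |] // _; last exact: leey.
rewrite lee_fin -subr_ge0.
apply: (@ge0_of_affine _ _ (inner (y - p) (y - p) / 2)) => t t0 t1.
have := @econvex_le f y p t b a fcvx t0 t1; rewrite fy fp => /(_ (lexx _) (lexx _)).
have := pmin (t *: y + (1 - t) *: p); rewrite fp.
case: (f (_ + _)) => [c| |] //; rewrite -!EFinD !lee_fin !halfsqnormE => h1 h2.
have : 0 <= t * (b - (a + inner (x - p) (y - p)) + t * (inner (y - p) (y - p) / 2)).
  move: h1 h2; rewrite !innerE (innerC p x) (innerC y x) (innerC y p); nra.
by rewrite pmulr_rge0.
Qed.

Lemma subgradient_minimizer f x p : Gamma0 f -> subgradient f p (x - p) ->
  unique (minimizer (fun y => f y + (halfsqnorm (x - y)%R)%:E)%E) p.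
Proof.
move=> f0 sub; have [a fp] := subgradient_fin f0 sub; have [fNy _ _ _] := f0.
(* Minimality with the quadratic excess [halfsqnorm (y - p)], which also forces uniqueness. *)
have key y b : f y = b%:E ->
    a + halfsqnorm (x - p) + halfsqnorm (y - p) <= b + halfsqnorm (x - y).
  move=> fy; have fle : (f y <= b%:E)%E by rewrite fy.
  have := subgradient_le sub fp fle.
  rewrite !halfsqnormE !innerE (innerC p x) (innerC y x) (innerC y p); lra.
split.
  move=> y; rewrite fp; case fy : (f y) (fNy y) => [b| |] // _; last first.
    by rewrite addye // leey.
  rewrite -!EFinD lee_fin; have := key _ _ fy.
  have : 0 <= halfsqnorm (y - p) by rewrite halfsqnormE divr_ge0 // inner_ge0.
  lra.
move=> q /(_ p); rewrite fp; case fq : (f q) (fNy q) => [b| |] // _.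
rewrite -!EFinD lee_fin => h; have := key _ _ fq; rewrite (halfsqnormE (q - p)) => h2.
apply/eqP; rewrite eq_sym -subr_eq0; apply/eqP/inner_eq0/eqP.
by rewrite eq_le inner_ge0 andbT; lra.
Qed.

(** The proximity operator is the resolvent of the subdifferential. Existence and uniqueness of the
    minimizer exclude the default value of [xget]. *)
Lemma prox_eqP f x p : Gamma0 f -> prox f x = p <-> subgradient f p (x - p).
Proof.
move=> f0.
have [q /(minimizer_subgradient f0) sq] := exists_prox x f0.
have uq := subgradient_minimizer f0 sq.
split=> [<-|/(subgradient_minimizer f0) [pmin _]].
  rewrite /prox; case: xgetP => [r _ [/(minimizer_subgradient f0)] //|].
  by move=> /(_ q).
rewrite /prox; case: xgetP => [r _ [_ ru]|/(_ q)//]; exact: ru.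
Qed.

Lemma prox_subgradient f x : Gamma0 f -> subgradient f (prox f x) (x - prox f x).
Proof. by move=> f0; apply/(prox_eqP _ _ f0). Qed.

End Gamma0Theory.

(** * Riesz representation and orthogonal projection as proximity operators *)

Section Hilbert.
Context {R : realType} {H : hilbertType R}.
Implicit Types (x y p u v : H) (t : R) (C : set H).

Definition indicator C x : \bar R := if x \in C then 0%E else +oo%E.

Lemma indicator_le C x a : (indicator C x <= a%:E)%E <-> C x /\ 0 <= a.
Proof.
rewrite /indicator; case: ifPn => xC.
  by rewrite lee_fin; split=> [|[]//]; split=> //; exact: set_mem.
by split=> // -[] /mem_set; rewrite (negPf xC).
Qed.

Lemma Gamma0_indicator C : C !=set0 -> closed C ->
  (forall t x y, 0 < t -> t < 1 -> C x -> C y -> C (t *: x + (1 - t) *: y)) ->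
  Gamma0 (indicator C).
Proof.
move=> [d Cd] Ccl Ccvx.
have iNy x : indicator C x != -oo%E by rewrite /indicator; case: ifP.
split => //.
- apply/lower_semicontinuousP => a.
  have [a0|a0] := leP 0 a.
    rewrite [X in open X](_ : _ = ~` C); first exact: closed_openC.
    apply/seteqP; split => x /=; rewrite ltNge.
      by move=> /negP + Cx; apply; apply/indicator_le.
    by move=> nCx; apply/negP => /indicator_le[].
  rewrite [X in open X](_ : _ = setT); first exact: openT.
  apply/seteqP; split => x //= _; rewrite ltNge; apply/negP => /indicator_le[_].
  by rewrite leNgt a0.
- apply: econvexP => // t x y a b t0 t1.
  rewrite {1 2}/indicator; case: ifPn => // /set_mem xC [<-].
  case: ifPn => // /set_mem yC [<-].
  by apply/indicator_le; split; [exact: Ccvx | lra].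
- exists d; rewrite /effective_domain /= /indicator ifT ?ltry //; exact: mem_set.
Qed.

Lemma Gamma0_cst0 : Gamma0 (fun _ : H => 0%E : \bar R).
Proof.
rewrite (_ : (fun=> _) = indicator setT).
  by apply: Gamma0_indicator => //; exists 0.
by apply/funext => x; rewrite /indicator in_setT.
Qed.

Lemma riesz (l : {linear H -> R^o}) : continuous (l : H -> R^o) ->
  exists p, forall x, l x = inner x p.
Proof.
move=> lcont.
have f0 : Gamma0 (fun x => (0 + (- l x)%:E)%E).
  apply: (Gamma0D Gamma0_cst0 (g := fun x => - l x)).
    by move=> x; apply: cvgN; exact: lcont.
  move=> t x y t0 t1.
  have -> : l (t *: x + (1 - t) *: y) = t * l x + (1 - t) * l y.
    by rewrite linearD !linearZ.
  by lra.
(* The representing vector minimizes [halfsqnorm - l]. Its subgradient inequality at [y + p] gives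
   one bound, and [- y] gives the other. *)
pose p := prox (fun x => (0 + (- l x)%:E)%E) 0.
have lp y : l y <= inner y p.
  have := prox_subgradient 0 f0 (y + p).
  have -> : l (y + p) = l y + l p by rewrite linearD.
  rewrite -/p addrK sub0r !add0e -EFinD lee_fin innerNl (innerC p y).
  set a : R := l p; set b : R := l y.
  by change (- a - inner y p <= - (b + a) -> b <= inner y p); lra.
exists p => y; apply/eqP; rewrite eq_le lp /=.
by have := lp (- y); rewrite innerNl linearN lerN2.
Qed.

Lemma closed_submoduleP C : closed_subspace C <->
  [/\ closed C, C 0 & forall t x y, C x -> C y -> C (t *: x + y)].
Proof.
split=> [[Ccl [C0 CD]]|[Ccl C0 CD]].
  split=> // [|t x y Cx Cy]; first exact: set_mem C0.
  by apply: set_mem; apply: CD; exact: mem_set.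
split=> //; split; first exact: mem_set.
by move=> t x y /set_mem Cx /set_mem Cy; apply: mem_set; exact: CD.
Qed.

Lemma orth_projection C x : closed_subspace C ->
  exists2 p, C p & forall v, C v -> inner v (x - p) = 0.
Proof.
move=> /closed_submoduleP[Ccl C0 CD].
have CZ t y : C y -> C (t *: y) by move=> Cy; rewrite -[_ *: _]addr0; exact: CD.
have f0 : Gamma0 (indicator C).
  apply: Gamma0_indicator => // [|t y z _ _ Cy Cz]; first by exists 0.
  by apply: CD => //; exact: CZ.
have sub := prox_subgradient x f0; set p := prox _ _ in sub.
(* Finiteness of the indicator at [p] places [p] in [C]; testing with [v + p] and [- v + p] then
   gives orthogonality. *)
have [a pa] := subgradient_fin f0 sub.
have /indicator_le [Cp _] : (indicator C p <= a%:E)%E by rewrite pa.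
have {pa}a0 : a = 0 by move: pa; rewrite /indicator mem_set // => -[].
have ip : indicator C p = 0%:E by rewrite /indicator mem_set.
have le0 v : C v -> inner v (x - p) <= 0.
  move=> Cv; have fv : (indicator C (v + p)%R <= 0%:E)%E.
    by apply/indicator_le; split=> //; rewrite -[v]scale1r; exact: CD.
  by have := subgradient_le sub ip fv; rewrite addrK add0r innerC.
exists p => // v Cv; apply/eqP; rewrite eq_le le0 //=.
by have := le0 (- v); rewrite -scaleN1r innerZl mulN1r oppr_le0; apply; exact: CZ.
Qed.

End Hilbert.

(** * The adjoint of a bounded operator *)

Section Adjoint.
Context {R : realType} {H G : hilbertType R}.

Lemma bounded_operator_continuous (M : {linear H -> G}) :
  bounded_operator M -> continuous M.
Proof.
move=> [c Mc]; apply: bounded_linear_continuous; apply/linear_boundedP.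
near=> r => y; apply: (le_trans (Mc _)).
by apply: ler_wpM2r => //; near: r; exact: nbhs_pinfty_ge.
Unshelve. all: by end_near. Qed.

Lemma adjointP (M : {linear H -> G}) : bounded_operator M ->
  forall x y, inner (M x) y = inner x (adjoint M y).
Proof.
move=> /bounded_operator_continuous Mcont x y; rewrite /adjoint.
case: xgetP => [u _ ->//|noadj].
(* The default value of [xget] is excluded by representing [inner y (M x)] through Riesz. *)
have lin : linear (fun x => inner y (M x) : R^o).
  by move=> t u v; rewrite linearP innerDr innerZr.
pose l : {linear H -> R^o} := HB.pack (fun x => inner y (M x) : R^o)
  (GRing.isLinear.Build _ _ _ _ _ lin).
have [|p lp] := riesz (l := l).
  move=> u; apply: (@continuous_comp _ _ _ M (inner y : G -> R^o)); first exact: Mcont.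
  exact: inner_continuous.
by case: (noadj p) => z; rewrite innerC; exact: lp.
Qed.

Lemma adjoint_bounded_linear (M : {linear H -> G}) : bounded_operator M ->
  linear (adjoint M) /\ bounded_operator (adjoint M).
Proof.
move=> Mb; have adj := adjointP Mb; split.
  by move=> t y z; apply: eq_inner => x; rewrite -adj !innerE !adj.
case: Mb => c Mc; exists `|c| => y.
set u := adjoint M y.
have [u0|] := eqVneq `|u| 0; first by rewrite u0 mulr_ge0.
rewrite -normr_gt0 normr_id => u0; rewrite -(ler_pM2l u0) -expr2 normsqE -adj.
apply: (le_trans (ler_norm _)); apply: (le_trans (cauchy_schwarz _ _)).
rewrite mulrA ler_wpM2r // (le_trans (Mc _)) // mulrC ler_wpM2l //.
exact: ler_norm.
Qed.

End Adjoint.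

(** * The conjugate of [f + q] and its minimization over a subspace *)

Section Conjugate.
Context {R : realType} {H : hilbertType R} (f : H -> \bar R) (f0 : Gamma0 f).
Implicit Types (x v w n m p d : H) (N W : set H).

(* The Fenchel conjugate of [f + q], written with the maximizer [prox f x] of
   [v |-> inner x v - f v - q v]. *)
Definition conj_halfsq x : R :=
  inner x (prox f x) - fine (f (prox f x)) - halfsqnorm (prox f x).

Lemma prox_fin x : exists a, f (prox f x) = a%:E.
Proof. exact: subgradient_fin f0 (prox_subgradient x f0). Qed.

Lemma fenchel_young x v b : (f v <= b%:E)%E ->
  inner x v - b - halfsqnorm v <= conj_halfsq x.
Proof.
move=> fv; have [a fp] := prox_fin x; rewrite /conj_halfsq fp /= !halfsqnormE.
have := subgradient_le (prox_subgradient x f0) fp fv.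
have := inner_ge0 (v - prox f x).
set p := prox f x; rewrite !innerE (innerC v p); lra.
Qed.

(* [prox f] is the gradient of the conjugate of [f + q]. *)
Lemma conj_halfsq_subgradient x x' :
  conj_halfsq x + inner (prox f x) (x' - x) <= conj_halfsq x'.
Proof.
have [a fp] := prox_fin x.
have fle : (f (prox f x) <= a%:E)%E by rewrite fp.
have := fenchel_young x' fle; rewrite [conj_halfsq x]/conj_halfsq fp /= !innerE.
rewrite (innerC x) (innerC x'); lra.
Qed.

(** Add the subgradient inequalities at the two proximal points. *)
Lemma prox_firmly_nonexpansive x x' :
  inner (prox f x - prox f x') (prox f x - prox f x') <=
  inner (x - x') (prox f x - prox f x').
Proof.
have [a fp] := prox_fin x; have [a' fp'] := prox_fin x'.
have fle : (f (prox f x) <= a%:E)%E by rewrite fp.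
have fle' : (f (prox f x') <= a'%:E)%E by rewrite fp'.
have := subgradient_le (prox_subgradient x f0) fp fle'.
have := subgradient_le (prox_subgradient x' f0) fp' fle.
set p := prox f x; set p' := prox f x'.
rewrite !innerE (innerC p' p); lra.
Qed.

(** The conjugate is the supremum of its affine minorants, so its sublevel sets are intersections of
    closed half-spaces. *)
Lemma closed_conj_sublevel (a : R) x0 :
  closed [set n | conj_halfsq (x0 + n) <= a].
Proof.
rewrite [X in closed X](_ : _ = \bigcap_(x in setT)
    ((inner (prox f x) : H -> R^o) @^-1`
      [set r : R | r <= a - conj_halfsq x + inner (prox f x) (x - x0)])).
  apply: closed_bigI => x _; apply: closed_comp; last exact: closed_le.
  by move=> ? _; exact: inner_continuous.
apply/seteqP; split => n /= h.
  move=> x _ /=; have := le_trans (conj_halfsq_subgradient x (x0 + n)) h.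
  rewrite !innerE; lra.
by have := h (x0 + n) I; rewrite /= !innerE; lra.
Qed.

Lemma midconvex_conj_sublevel (a : R) x0 :
  midconvex [set n | conj_halfsq (x0 + n) <= a].
Proof.
move=> n m /= hn hm; set k := 2^-1 *: (n + m).
have := le_trans (conj_halfsq_subgradient (x0 + k) (x0 + n)) hn.
have := le_trans (conj_halfsq_subgradient (x0 + k) (x0 + m)) hm.
by set p := prox f _; rewrite {2 4}/k !innerE; lra.
Qed.

(* Attouch-Brezis in dual form: the qualification [qual] and the uniform
   boundedness principle make the sublevel sets of the conjugate bounded on
   [N `&` W]; the conjugate then has a minimizer there, at which its gradient
   [prox f] is orthogonal to [N]. *)
Lemma exists_prox_orth N W x0 : closed_subspace N -> closed_subspace W ->
  (forall w, W w -> exists t v d, [/\ 0 < t,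
     forall n, N n -> inner n v = 0, (f d < +oo)%E & w = t *: (v - d)]) ->
  (forall d, (f d < +oo)%E -> W d) ->
  (forall n, N n -> exists m, [/\ N m, W m &
     forall v, W v -> inner v (n - m) = 0]) ->
  exists2 n, N n & forall m, N m -> inner m (prox f (x0 + n)) = 0.
Proof.
move=> /closed_submoduleP[Ncl N0 ND] Wsub qual domW projN.
have [Wcl W0 WD] := (closed_submoduleP W).1 Wsub.
have NZ t n : N n -> N (t *: n) by move=> Nn; rewrite -[_ *: _]addr0; exact: ND.
pose F n : \bar R := (indicator (N `&` W) n + (conj_halfsq (x0 + n))%:E)%E.
have FleP n a : (F n <= a%:E)%E <-> [/\ N n, W n & conj_halfsq (x0 + n) <= a].
  rewrite /F /indicator; case: ifPn => [/set_mem [Nn Wn]|nNW].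
    by rewrite add0e lee_fin; split=> [|[]].
  by split=> // -[Nn Wn _]; move: nNW; rewrite mem_set.
pose c := conj_halfsq x0.
have [B FB] : exists B, forall n, (F n <= c%:E)%E -> `|n| <= B.
  pose S := [set n | (F n <= c%:E)%E].
  (* Since [v] is orthogonal to [N], only [d] contributes to [inner n w], and Fenchel-Young at [d]
     controls it. *)
  have low w : W w -> exists b : R, forall n, S n -> b <= inner n w.
    move=> /qual[t [v [d [t0 vN fd ->]]]].
    have [b fdE] := effective_domainP f0 fd.
    have fle : (f d <= b%:E)%E by rewrite fdE.
    exists (- t * (c + b + halfsqnorm d - inner x0 d)) => n /FleP[Nn _ nc].
    have := le_trans (fenchel_young (x0 + n) fle) nc.
    rewrite innerZr innerDr innerNr vN // sub0r mulrN mulNr lerN2 ler_pM2l //.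
    by rewrite innerDl; lra.
  have ubp : uniform_bounded [set (inner n : H -> R^o) | n in S].
    apply: Banach_Steinhauss.
      move=> _ [n _ <-]; split; last exact: linearP.
      move=> r; exists (`|n| * r) => x xr.
      by rewrite (le_trans (cauchy_schwarz _ _)) // ler_wpM2l.
    (* Elements of [S] lie in [W], so [x] may be replaced by its projection [w]; [low] at [w] and
       [- w] bounds both sides. *)
    move=> x; have [w Ww xw] := orth_projection x Wsub.
    have [b1 hb1] := low _ Ww.
    have Wnw : W (- w) by rewrite -scaleN1r -[_ *: _]addr0; exact: WD.
    have [b2 hb2] := low _ Wnw.
    exists (`|b1| + `|b2|) => _ [n Sn <-].
    have [_ Wn _] := (FleP _ _).1 Sn.
    have -> : inner n x = inner n w by have := xw _ Wn; rewrite innerDr innerNr; lra.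
    have := hb1 _ Sn; have := hb2 _ Sn; rewrite innerNr.
    have := ler_norm (- b1); have := ler_norm (- b2); rewrite !normrN.
    have := normr_ge0 b1; have := normr_ge0 b2.
    by move=> *; rewrite ler_norml; apply/andP; split; lra.
  have [B hB] := ubp 1; exists `|B| => n Sn.
  have [->|n0] := eqVneq n 0; first by rewrite normr0.
  have nn0 : `|n| != 0 by rewrite normr_eq0.
  have := hB _ (ex_intro2 _ _ n Sn erefl) (`|n|^-1 *: n).
  rewrite normrZ normfV normr_id mulVf // => /(_ (lexx _)).
  rewrite innerZr -normsqE expr2 mulKf // normr_id => nB.
  exact: le_trans (ler_norm _).
have [n nmin] : exists n, minimizer F n.
  apply: (@exists_minimizer _ _ F c B) => //.
  - move=> a; rewrite [X in closed X](_ : _ =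
        N `&` W `&` [set n | conj_halfsq (x0 + n) <= a]).
      by apply: closedI; [exact: closedI | exact: closed_conj_sublevel].
    by apply/seteqP; split=> n /=; rewrite FleP => -[]; [|case].
  - move=> a n m /= /FleP[Nn Wn na] /FleP[Nm Wm ma]; apply/FleP; split.
    + by rewrite scalerDr; apply: ND => //; exact: NZ.
    + rewrite scalerDr; apply: (WD) => //.
      by rewrite -[_ *: m]addr0; exact: WD.
    + exact: midconvex_conj_sublevel.
  - by exists 0; apply/FleP; rewrite addr0.
have [Nn Wn _] : [/\ N n, W n & conj_halfsq (x0 + n) <= c].
  apply/FleP; apply: (le_trans (nmin 0)); apply/FleP.
  by rewrite addr0; split.
(* Minimality extends from the intersection with [W] to all of [N]: the gradient at [x0 + k] lies in
   the domain of [f], hence in [W], and is orthogonal to [m - k]. *)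
have Nmin m : N m -> conj_halfsq (x0 + n) <= conj_halfsq (x0 + m).
  move=> /projN[k [Nk Wk mk]].
  have nk : (F k <= (conj_halfsq (x0 + k))%:E)%E by apply/FleP.
  have /FleP[_ _ nk'] := le_trans (nmin k) nk.
  apply: (le_trans nk').
  have := conj_halfsq_subgradient (x0 + k) (x0 + m).
  rewrite opprD addrACA subrr add0r mk ?addr0 //; apply: domW.
  by have [a ->] := prox_fin (x0 + k); exact: ltry.
exists n => //.
have ge0 m : N m -> 0 <= inner m (prox f (x0 + n)).
  move=> Nm; apply: (@ge0_of_affine _ _ (inner m m)) => t t0 _.
  pose x := x0 + (t *: m + n); pose p := prox f (x0 + n).
  have xE : x - (x0 + n) = t *: m by rewrite /x addrCA addrK.
  (* The gradient inequality at the displaced point [x] gives the sign there; firm nonexpansiveness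
     carries it back to [x0 + n] with an error at most [t * inner m m]. *)
  have : 0 <= inner m (prox f x).
    rewrite -(pmulr_rge0 _ t0) -innerZl -xE innerC.
    have := conj_halfsq_subgradient x (x0 + n).
    have := Nmin (t *: m + n) (ND _ _ _ Nm Nn); rewrite -/x !innerE; lra.
  have := prox_firmly_nonexpansive x (x0 + n); rewrite xE -/p.
  have -> : prox f x = (prox f x - p) + p by rewrite subrK.
  move: (prox f x - p) => e; rewrite addrK => h1; rewrite innerDr => h2.
  have := inner_ge0 (e - t *: m); move: h1; rewrite !innerE (innerC e m) => h1 h3.
  have : t * inner m e <= t * (t * inner m m) by lra.
  rewrite ler_pM2l //; lra.
move=> m Nm; apply/eqP; rewrite eq_le ge0 // andbT.
by have := ge0 (-1 *: m) (NZ _ _ Nm); rewrite innerZl mulN1r oppr_ge0.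
Qed.

End Conjugate.

(** * Parallel composition and the function [phi] *)

Section ParallelComposition.
Context {R : realType} {H G : hilbertType R}.
Context (M : {linear H -> G}) (Ms : {linear G -> H}) (Mscont : continuous Ms)
  (adj : forall x y, inner (M x) y = inner x (Ms y))
  (pos : forall y : G, inner y y <= inner (Ms y) (Ms y)).

Definition pullback (f : H -> \bar R) (y : G) : \bar R :=
  (f (Ms y) + (halfsqnorm (Ms y))%:E - (halfsqnorm y)%:E)%E.

Lemma Gamma0_comp f : Gamma0 f -> (exists y, (f (Ms y) < +oo)%E) ->
  Gamma0 (f \o Ms).
Proof.
move=> [fNy flsc fcvx _] dom; split=> //.
- by move=> y; exact: fNy.
- apply/lower_semicontinuousP => a.
  apply: (@open_comp _ _ Ms [set x | (a%:E < f x)%E]).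
    by move=> ? _; exact: Mscont.
  by move/lower_semicontinuousP : flsc; exact.
- by move=> t x y t0 t1; rewrite /= linearD !linearZ; exact: fcvx.
Qed.

(** By [pos], the quadratic form [inner (Ms y) (Ms y) - inner y y] is nonnegative, so the quadratic
    term added to [f \o Ms] is convex. *)
Lemma Gamma0_pullback f : Gamma0 f -> (exists y, (f (Ms y) < +oo)%E) ->
  Gamma0 (pullback f).
Proof.
move=> f0 dom.
pose g y : R := halfsqnorm (Ms y) - halfsqnorm y.
rewrite (_ : pullback f = fun y => ((f \o Ms) y + (g y)%:E)%E); last first.
  by apply/funext => y; rewrite /pullback EFinB addeA.
apply: (Gamma0D (Gamma0_comp f0 dom)).
  move=> y; apply: cvgB; last exact: halfsqnorm_continuous.
  apply: (@continuous_comp _ _ _ Ms (@halfsqnorm R H : H -> R^o)); first exact: Mscont.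
  exact: halfsqnorm_continuous.
move=> t x y t0 t1; rewrite /g.
have -> : Ms (t *: x + (1 - t) *: y) = t *: Ms x + (1 - t) *: Ms y.
  by rewrite linearD !linearZ.
rewrite !halfsqnormE !innerE.
rewrite (innerC y x) (innerC (Ms y) (Ms x)).
have h := pos (x - y); rewrite (linearB Ms) in h.
have : 0 <= t * (1 - t) * (inner (Ms x - Ms y) (Ms x - Ms y) - inner (x - y) (x - y)).
  by apply: mulr_ge0; [apply: mulr_ge0; lra | lra].
rewrite !innerE (innerC y x) (innerC (Ms y) (Ms x)); nra.
Qed.

(* The quadratic [(|Ms y|^2 - |y|^2) / 2] is the case [f = 0]; its proximity
   operator inverts [M \o Ms]. *)
Lemma comp_adjoint_onto y : exists z, M (Ms z) = y.
Proof.
have g0 : Gamma0 (pullback (fun=> 0%E)).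
  apply: (Gamma0_pullback Gamma0_cst0); exists 0; exact: ltry.
set g := pullback _ in g0.
have gE z : g z = (halfsqnorm (Ms z) - halfsqnorm z)%:E.
  by rewrite /g /pullback add0e EFinB.
exists (prox g y); set z := prox g y.
(* Optimality of [z] in direction [w]; with [- w] it becomes the equation [M (Ms z) = y]. *)
have le0 w : 0 <= inner w (M (Ms z)) - inner w y.
  apply: (@ge0_of_affine _ _ ((inner (Ms w) (Ms w) - inner w w) / 2)) => t t0 _.
  have := prox_subgradient y g0 (t *: w + z).
  rewrite -/z !gE -EFinD lee_fin addrK (linearP Ms) !halfsqnormE !innerE.
  rewrite (innerC z w) (innerC (Ms z) (Ms w)) (innerC y w).
  rewrite [inner w (M _)]innerC adj (innerC (Ms z)) => h.
  have : 0 <= t * (inner (Ms w) (Ms z) - inner w y +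
      t * ((inner (Ms w) (Ms w) - inner w w) / 2)) by lra.
  by rewrite pmulr_rge0.
apply: eq_inner => w; apply/eqP; rewrite -subr_eq0 eq_le le0 andbT.
by have := le0 (- w); rewrite !innerNl; lra.
Qed.

(** The subgradient [x - Ms p] of [f] at [Ms p] is transported by adjointness. The quadratic terms
    leave half of [inner (Ms (z - p)) (Ms (z - p)) - inner (z - p) (z - p)], nonnegative by
    [pos]. *)
Lemma prox_pullback f x p : Gamma0 f -> prox f x = Ms p ->
  prox (pullback f) (M x) = p.
Proof.
move=> f0 fx; have sub := prox_subgradient x f0; rewrite fx in sub.
have [a fa] := subgradient_fin f0 sub; have [fNy _ _ _] := f0.
apply/prox_eqP.
  by apply: Gamma0_pullback => //; exists p; rewrite fa ltry.
move=> z; rewrite /pullback fa.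
case fz : (f (Ms z)) (fNy (Ms z)) => [b| |] // _; last by rewrite leey.
have fle : (f (Ms z) <= b%:E)%E by rewrite fz.
have := subgradient_le sub fa fle; rewrite -(linearB Ms) -!EFinD lee_fin.
rewrite innerDl -adj (linearB Ms) => h.
have := pos (z - p); rewrite (linearB Ms) !halfsqnormE !innerE.
move: h; rewrite !innerE (innerC z p) (innerC (Ms z) (Ms p)); lra.
Qed.

Definition qualification f :=
  sri [set u - v | u in range Ms & v in effective_domain f] 0.

Lemma qualification_dom f : qualification f -> exists y, (f (Ms y) < +oo)%E.
Proof.
case=> -[_ [y _ <-] [v fv /eqP]]; rewrite subr_eq0 => /eqP yv _.
by exists y; rewrite yv.
Qed.

(** This makes the parallel composition nonempty at every [y]. *)
Lemma exists_prox_range f y : Gamma0 f -> qualification f ->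
  exists x p, M x = y /\ prox f x = Ms p.
Proof.
move=> f0 qual; have [y0 fy0] := qualification_dom qual.
case: qual => _; set C := [set _ - 0 | _ in _]; set W := generated_cone C => Wsub.
have [Wcl W0 WD] := (closed_submoduleP W).1 Wsub.
have CW c : C c -> W c by move=> Cc; exists 1 => //; exists c; rewrite ?scale1r.
have CE z v : (f v < +oo)%E -> C (Ms z - v).
  move=> fv; exists (Ms z - v); last by rewrite subr0.
  by exists (Ms z); [exists z | exists v].
have domW d : (f d < +oo)%E -> W d.
  move=> fd; have := CW _ (CE 0 _ fd); rewrite linear0 sub0r => Wd.
  by rewrite -[d]opprK -scaleN1r -[_ *: _]addr0; exact: WD.
have ranW z : W (Ms z).
  have := CW _ (CE (z + y0) _ fy0); by rewrite linearD addrK.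
pose N := [set n | M n = 0].
have Nsub : closed_subspace N.
  apply/closed_submoduleP; split=> [||t u v /= Mu Mv].
  - rewrite (_ : N = [set n | forall v, range Ms v -> inner v n = 0]).
      exact: closed_orth.
    apply/seteqP; split=> n /= Nn.
      by move=> _ [v _ <-]; rewrite innerC -adj Nn inner0l.
    apply: eq_inner => v; rewrite inner0r innerC adj innerC; apply: Nn.
    by exists v.
  - exact: linear0.
  - by rewrite /N /= linearP Mu Mv scaler0 addr0.
have [z zy] := comp_adjoint_onto y.
have qualW w : W w -> exists t v d, [/\ 0 < t,
    forall n, N n -> inner n v = 0, (f d < +oo)%E & w = t *: (v - d)].
  move=> [t t0 [_ [_ [_ [u _ <-] [d fd <-]] <-] ->]].
  exists t, (Ms u), d; split => //; last by rewrite subr0.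
  by move=> m Nm; rewrite -adj Nm inner0l.
(* [W] contains the range of [Ms], so [m - k], orthogonal to [W], is killed by [M]; hence [k] stays
   in [N]. *)
have projN m : N m -> exists k, [/\ N k, W k & forall v, W v -> inner v (m - k) = 0].
  move=> Nm; have [k Wk mk] := orth_projection m Wsub.
  exists k; split => //; rewrite /N /= -[k](subKr m) linearB /= Nm sub0r.
  apply/eqP; rewrite oppr_eq0; apply/eqP/eq_inner => v.
  by rewrite inner0r innerC adj innerC mk.
have [n Nn north] := exists_prox_orth f0 (Ms z) Nsub Wsub qualW domW projN.
(* Solving [M (Ms p) = M q] puts [q - Ms p] in [N]; both terms are orthogonal to [N], so the
   difference vanishes. *)
set q := prox f _ in north; have [p pq] := comp_adjoint_onto (M q).
exists (Ms z + n), p; split; first by rewrite linearD zy /= Nn addr0.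
have Nd : N (q - Ms p) by rewrite /N /= linearB pq subrr.
apply/eqP; rewrite -subr_eq0; apply/eqP/inner_eq0.
by rewrite innerDr innerNr north // -adj Nd inner0l subrr.
Qed.

End ParallelComposition.

Theorem proposition3p8 (R : realType) (H G : hilbertType R)
    (f : H -> \bar R) (M : {linear H -> G}) :
  Gamma0 f ->
  bounded_operator M ->
  sri [set u - v | u in range (adjoint M) & v in effective_domain f] 0 ->
  positive_operator (fun y : G => M (adjoint M y) - y) ->
  let phi : G -> \bar R := fun y =>
    (f (adjoint M y) + (halfsqnorm (adjoint M y))%:E - (halfsqnorm y)%:E)%E in
  (exists2 T : G -> G, prox_operators T &
     parallel_comp M (graph (prox f)) = graph T) /\
  (Gamma0 phi /\ parallel_comp M (graph (prox f)) = graph (prox phi)).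
Proof.
move=> f0 Mb qual pos phi.
have [adjlin adjb] := adjoint_bounded_linear Mb.
pose Ms : {linear G -> H} := HB.pack (adjoint M)
  (GRing.isLinear.Build _ _ _ _ _ adjlin).
have Mscont : continuous Ms by exact: bounded_operator_continuous.
have adj x y : inner (M x) y = inner x (Ms y) by exact: adjointP.
have Mspos y : inner y y <= inner (Ms y) (Ms y).
  by have := pos y; rewrite innerDr innerNr subr_ge0 innerC adj.
have phi0 : Gamma0 phi.
  exact: (Gamma0_pullback Mscont Mspos f0 (qualification_dom (Ms := Ms) qual)).
have parE : parallel_comp M (graph (prox f)) = graph (prox phi).
  apply/funext => y; apply/seteqP; split => p /=.
    move=> [x [_ -> /esym xp] yE].
    rewrite /graph /= yE; apply/esym; exact: (prox_pullback Mscont adj Mspos f0).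
  (* Conversely, some [q] is a value of the composition at [y], and [prox_pullback] identifies it
     with [prox phi y]. *)
  have [x [q [Mx xq]]] := exists_prox_range Mscont adj Mspos y f0 qual.
  have := prox_pullback Mscont adj Mspos f0 xq; rewrite Mx => qE pE.
  exists x => //; exists (Ms q); last by rewrite /svinv /graph /= xq.
  by rewrite /graph /= pE -[q]qE.
by split; [exists (prox phi) => //; exists phi | split].
Qed.
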